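(* Let $S$ be a semilattice-ordered semigroup. The downward-join closure operator $(-)^{\mathrm{dj}}:\mathcal{P}(S)\to\mathcal{P}(S)$ is algebraic and multiplicative.
   Context: A semilattice-ordered semigroup is a triple $(S,\cdot,\lor)$ with $S$ nonempty, $(S,\cdot)$ a semigroup, $(S,\lor)$ a semilattice (commutative, associative, idempotent), and $x(y\lor z)=xy\lor xz$, $(x\lor y)z=xz\lor yz$ for all $x,y,z\in S$. It is partially ordered by $x\leqslant y\iff x\lor y=y$. For $A,B\subseteq S$, $AB=\{ab\mid a\in A,b\in B\}$. $\mathcal{P}(S)$ is the power set of $S$ and $\mathcal{P}_{\mathrm{fin}}(A)$ is the set of finite subsets of $A$. For $A\subseteq S$ put $A^\lor=\{a_1\lor\ldots\lor a_n\mid n\geqslant1,\ a_i\in A\}$ and $A^{\mathrm{dj}}=\{x\in S\mid\exists a\in A^\lor\text{ such that }x\lor a=a\}$ (so $\varnothing^{\mathrm{dj}}=\varnothing$); $A\mapsto A^{\mathrm{dj}}$ is a closure operator on $S$ (extensive, idempotent, order-preserving), called the downward-join closure. A closure operator $\mathrm{cl}$ on $S$, written $A\mapsto A^{\mathrm{cl}}$, is algebraic if $A^{\mathrm{cl}}=\bigcup\{F^{\mathrm{cl}}\mid F\in\mathcal{P}_{\mathrm{fin}}(A)\}$ for every $A\subseteq S$, and multiplicative if $(AB)^{\mathrm{cl}}=(A^{\mathrm{cl}}B^{\mathrm{cl}})^{\mathrm{cl}}$ for all $A,B\subseteq S$. *)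

(* Defs.v *)
From HB Require Import structures.
From mathcomp Require Import all_boot all_order.
From mathcomp Require Import all_classical.

Set Implicit Arguments.
Unset Strict Implicit.
Unset Printing Implicit Defensive.

Import Order.TTheory.

Local Open Scope classical_set_scope.

(* The order of the library's [joinSemilatticeType] satisfies
   x <= y <-> x `|` y = y, so it is the order of the semilattice (S, \/).
   Its [choiceType] layer is no restriction: [boolp] provides one on any type. *)
HB.mixin Record isSemilatticeOrdered (d : Order.disp_t) S
    of Semigroup S & Order.JoinSemilattice d S := {
  slo_nonempty : inhabited S;
  mulg_joinr : forall x y z : S,
    (x * (y `|` z)%O)%g = ((x * y)%g `|` (x * z)%g)%O;
  mulg_joinl : forall x y z : S,
    ((x `|` y)%O * z)%g = ((x * z)%g `|` (y * z)%g)%O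
}.

#[short(type="sloSemigroupType")]
HB.structure Definition SLOSemigroup (d : Order.disp_t) :=
  { S of isSemilatticeOrdered d S & Semigroup S & Order.JoinSemilattice d S }.

Definition setmulg (S : magmaType) (A B : set S) : set S :=
  [set (a * b)%g | a in A & b in B].

Record closure_operator (T : Type) := ClosureOperator {
  closure_fun :> set T -> set T;
  closure_extensive : forall A, A `<=` closure_fun A;
  closure_idempotent : forall A, closure_fun (closure_fun A) = closure_fun A;
  closure_monotone : forall A B, A `<=` B -> closure_fun A `<=` closure_fun B
}.

Definition algebraic (T : Type) (cl : closure_operator T) : Prop :=
  forall A : set T,
    cl A = \bigcup_(F in [set F | finite_set F /\ F `<=` A]) cl F.

Definition multiplicative (S : magmaType) (cl : closure_operator S) : Prop :=
  forall A B : set S, cl (setmulg A B) = cl (setmulg (cl A) (cl B)).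

Section DownwardJoinClosure.
Context {d : Order.disp_t} {S : joinSemilatticeType d}.
Implicit Types (A B : set S) (x y : S).

(* The nonempty family a_1, ..., a_n is the list a :: s, and
   foldl Order.join a s is (... (a_1 \/ a_2) \/ ...) \/ a_n. *)
Definition join_closure A : set S :=
  [set x | exists (a : S) (s : seq S),
     [set` a :: s] `<=` A /\ x = foldl Order.join a s].

Definition down_join A : set S :=
  [set x | exists2 a, join_closure A a & (x `|` a)%O = a].

Lemma join_closureU A x y :
  join_closure A x -> join_closure A y -> join_closure A (x `|` y)%O.
Proof.
move=> [a [s [sA ->]]] [b [t [tA ->]]].
exists a, (s ++ b :: t); split.
  move=> z /=; rewrite -cat_cons mem_cat => /orP[]; [exact: sA|exact: tA].
rewrite foldl_cat /=; move: (foldl _ a s) => c {tA}.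
by elim: t b => [//|e t IH] b /=; rewrite -joinA IH.
Qed.

Lemma down_join_extensive A : A `<=` down_join A.
Proof.
move=> x Ax; exists x; last by rewrite joinxx.
by exists x, [::]; split=> // y /=; rewrite inE => /eqP->.
Qed.

Lemma down_join_monotone A B : A `<=` B -> down_join A `<=` down_join B.
Proof.
move=> AB x [_ [a [s [sA ->]]] xa]; exists (foldl Order.join a s) => //.
by exists a, s; split=> // y /sA /AB.
Qed.

Lemma down_joinU A x y :
  down_join A x -> down_join A y -> down_join A (x `|` y)%O.
Proof.
move=> [a Aa xa] [b Ab yb]; exists (a `|` b)%O; first exact: join_closureU.
by rewrite joinACA xa yb.
Qed.

Lemma down_join_idempotent A : down_join (down_join A) = down_join A.
Proof.
apply/seteqP; split; last exact: down_join_extensive.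
move=> x [_ [a [s [sA ->]]] xa].
have: down_join A (foldl Order.join a s).
  have : down_join A a by apply: sA; rewrite /= mem_head.
  have : forall y, y \in s -> down_join A y.
    by move=> y ys; apply: sA; rewrite /= inE ys orbT.
  elim: s a {sA xa} => [//|b s IH] a /= sA Aa.
  apply: IH => [y ys|]; first by apply: sA; rewrite inE ys orbT.
  by apply: down_joinU => //; apply: sA; rewrite mem_head.
case=> b Ab eb; exists b => //.
by rewrite -[in LHS]eb joinA xa eb.
Qed.

Definition down_join_closure : closure_operator S :=
  ClosureOperator down_join_extensive down_join_idempotent down_join_monotone.

End DownwardJoinClosure.

(* Main.v *)
Require Import Defs.
From HB Require Import structures.
From mathcomp Require Import all_boot all_order.
From mathcomp Require Import all_classical.

(** The set [down_join A] is the least subset of [S] that contains [A] and is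
    closed under binary joins and under passing to smaller elements, that is,
    the (possibly empty) order ideal generated by [A].

    Algebraicity holds because membership of [x] in [down_join A] is witnessed
    by a single finite join of elements of [A], hence by a finite subset of [A].

    Multiplicativity reduces to the inclusion of the product of [down_join A]
    and [down_join B] in [down_join (setmulg A B)].  By distributivity, left and
    right translations preserve joins, hence the order, so the preimage of an
    ideal under a translation is an ideal.  Minimality of the generated ideal
    then allows replacing first [A] by [down_join A] and afterwards [B] by
    [down_join B]: for fixed [b] in [B], the elements [x] such that [x * b] lies
    in [down_join (setmulg A B)] form an ideal containing [A]; for fixed [x] in
    [down_join A], the elements [y] such that [x * y] lies there form an ideal
    containing [B]. *)

Set Implicit Arguments.
Unset Strict Implicit.
Unset Printing Implicit Defensive.

Import Order.TTheory.

Local Open Scope classical_set_scope.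

Section JoinIdeals.
Context {d : Order.disp_t} {S : joinSemilatticeType d}.
Implicit Types (A I : set S) (x y : S).

(** The empty set counts as an ideal, in accordance with
    [down_join set0 = set0]. *)
Definition join_ideal I : Prop :=
  (forall x y, I x -> I y -> I (x `|` y)%O) /\
  (forall x y, (x <= y)%O -> I y -> I x).

Lemma down_join_ideal A : join_ideal (down_join A).
Proof.
split=> [x y|x y xy [a Aa /join_idPr ya]]; first exact: down_joinU.
by exists a => //; apply/join_idPr; apply: le_trans xy ya.
Qed.

(** Minimality of the generated ideal; this is what lets a property be checked
    on generators only. *)
Lemma down_join_min A I : join_ideal I -> A `<=` I -> down_join A `<=` I.
Proof.
move=> [IU Ile] AI x [_ [a [s [sA ->]]] /join_idPr xa]; apply: Ile xa _.
have Ia : I a by apply/AI/sA; rewrite /= mem_head.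
have Is y : y \in s -> I y by move=> ys; apply/AI/sA; rewrite /= inE ys orbT.
elim: s a Ia Is {sA} => [//|b s IH] a /= Ia Is.
apply: IH => [|y ys]; last by apply: Is; rewrite inE ys orbT.
by apply: IU => //; apply: Is; rewrite mem_head.
Qed.

(** A join-preserving map is monotone, so it pulls ideals back to ideals. *)
Lemma join_ideal_preimage (f : S -> S) I :
  {morph f : x y / (x `|` y)%O} -> join_ideal I -> join_ideal (f @^-1` I).
Proof.
move=> fU [IU Ile]; split=> [x y Ix Iy|x y /join_idPr xy].
  by rewrite /preimage /= fU; apply: IU.
by apply: Ile; apply/join_idPr; rewrite -fU xy.
Qed.

(** The finite set that works for [x] consists of the entries of any finite
    join witnessing that [x] belongs to the closure. *)
Lemma down_join_algebraic : algebraic (@down_join_closure d S).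
Proof.
move=> A; apply/seteqP; split=> x; last first.
  by case=> F [_ FA]; apply: down_join_monotone.
move=> [_ [a [s [sA ->]]] xa]; exists [set` a :: s]; first by split.
by exists (foldl Order.join a s) => //; exists a, s; split.
Qed.

End JoinIdeals.

Section Multiplicativity.
Context {d : Order.disp_t} {S : sloSemigroupType d}.
Implicit Types A B : set S.

Lemma setmulg_down_join A B :
  setmulg (down_join A) (down_join B) `<=` down_join (setmulg A B).
Proof.
have idAB := down_join_ideal (setmulg A B).
have mulB b : B b ->
    down_join A `<=` (fun x => (x * b)%g) @^-1` down_join (setmulg A B).
  move=> Bb; apply: down_join_min => [|a Aa].
    by apply: join_ideal_preimage => // x y; apply: mulg_joinl.
  by apply: down_join_extensive; exists a => //; exists b.
move=> _ [x Ax [y By <-]].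
suff: down_join B `<=` (fun z => (x * z)%g) @^-1` down_join (setmulg A B).
  exact.
apply: down_join_min => [|b Bb]; last exact: mulB.
by apply: join_ideal_preimage => // u v; apply: mulg_joinr.
Qed.

Lemma down_join_multiplicative : multiplicative (@down_join_closure d S).
Proof.
move=> A B; apply/seteqP; split.
  apply: down_join_monotone => _ [a Aa [b Bb <-]].
  by exists a; [|exists b]; rewrite //; apply: down_join_extensive.
exact: down_join_min (down_join_ideal _) (@setmulg_down_join A B).
Qed.

End Multiplicativity.

Theorem proposition5p4 (d : Order.disp_t) (S : sloSemigroupType d) :
  algebraic (@down_join_closure d S) /\ multiplicative (@down_join_closure d S).
Proof.
split; [exact: down_join_algebraic | exact: down_join_multiplicative].
Qed.
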